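(* Let $\lambda$ be a partition of a positive integer, let $t\geq \ell(\lambda)$ be an integer, and let $\varphi_n\mathrm{JT}_\lambda$ be the $t\times t$ matrix over the polynomial ring $\mathbb{Q}[n]$ (with $n$ an indeterminate) given by $$\varphi_n\mathrm{JT}_\lambda=\left[\binom{n+\lambda_i+j-i-1}{\lambda_i+j-i}\right]_{i,j=1}^t .$$ Let the Smith normal form of $\varphi_n\mathrm{JT}_\lambda$ over $\mathbb{Q}[n]$ have main diagonal $(\alpha_1,\alpha_2,\dots,\alpha_t)$. Then we can take $$\alpha_i=\prod_{u\in D_{t-i+1}}(n+c(u)),\qquad 1\leq i\leq t,$$ where $D_k$ is the $k$th diagonal hook of $\lambda$ and $c(u)$ is the content of the square $u$. That is, the diagonal matrix with these diagonal entries is a Smith normal form of $\varphi_n\mathrm{JT}_\lambda$ over $\mathbb{Q}[n]$.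
   Context: A partition $\lambda=(\lambda_1\geq\lambda_2\geq\cdots)$ has length $\ell(\lambda)$, its number of nonzero parts; set $\lambda_i=0$ for $i>\ell(\lambda)$. Identify $\lambda$ with its Young diagram, the set of squares $(i,j)$ with $1\leq i\leq\ell(\lambda)$, $1\leq j\leq\lambda_i$. The content of the square $u=(i,j)$ is $c(u)=j-i$. The $k$th diagonal hook $D_k$ ($k\geq 1$) of $\lambda$ is the set of all squares $(i,j)\in\lambda$ such that either $i=k$ and $j\geq k$, or $j=k$ and $i\geq k$ (possibly empty). An empty product equals $1$. For an integer $m\geq 1$, $\binom{n+m-1}{m}$ denotes the polynomial $\frac{n(n+1)\cdots(n+m-1)}{m!}\in\mathbb{Q}[n]$; for $m=0$ it is $1$ and for $m<0$ it is $0$. (The matrix $\varphi_n\mathrm{JT}_\lambda$ arises from the Jacobi-Trudi matrix $\mathrm{JT}_\lambda=[h_{\lambda_i+j-i}]_{i,j=1}^t$, where $h_m$ is the complete homogeneous symmetric function of degree $m$, $h_0=1$, $h_m=0$ for $m<0$, by setting $x_1=\cdots=x_n=1$ and all other $x_i=0$.) A Smith normal form of a nonsingular $t\times t$ matrix $M$ over a commutative ring $R$ is a diagonal matrix $PMQ$, with $P,Q$ invertible $t\times t$ matrices over $R$, whose diagonal entries $\alpha_1,\dots,\alpha_t$ satisfy $\alpha_i\mid\alpha_{i+1}$ in $R$ for $1\leq i\leq t-1$. Over a principal ideal domain it exists and its diagonal entries are unique up to multiplication by units; ''we can take'' refers to this freedom. *)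

(* Defs.v *)
From mathcomp Require Import all_boot all_order all_algebra.

Set Implicit Arguments.
Unset Strict Implicit.
Unset Printing Implicit Defensive.

Import GRing.Theory.
Local Open Scope ring_scope.

(* Parts are required to be nonzero, so that the length of la is size la and
   nth 0 la i = 0 beyond it.  Rows, columns and diagonal hooks are numbered
   from 0: square (i, j) here is (i + 1, j + 1) in the usual convention and
   diag_hook la k is D_{k+1}; contents are unaffected by the shift. *)
Definition is_partition (la : seq nat) : bool :=
  sorted geq la && (0%N \notin la).

Definition part (la : seq nat) (i : nat) : nat := nth 0%N la i.

Definition young_diagram (la : seq nat) : seq (nat * nat) :=
  [seq (i, j) | i <- iota 0 (size la), j <- iota 0 (part la i)].

Definition content (u : nat * nat) : int := u.2%:Z - u.1%:Z.

Definition diag_hook (la : seq nat) (k : nat) : seq (nat * nat) :=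
  [seq u <- young_diagram la |
     ((u.1 == k) && (k <= u.2)%N) || ((u.2 == k) && (k <= u.1)%N)].

(* The binomial coefficient (n + m - 1 choose m) as a polynomial in n = 'X. *)
Definition binom_poly (m : int) : {poly rat} :=
  match m with
  | Posz k => (k`!%:R)^-1 *: \prod_(i < k) ('X + i%:R)
  | Negz _ => 0
  end.

Definition phi_JT (la : seq nat) (t : nat) : 'M[{poly rat}]_t :=
  \matrix_(i < t, j < t) binom_poly ((part la i)%:Z + j%:Z - i%:Z).

Definition ring_dvd (R : comUnitRingType) (a b : R) : Prop :=
  exists c : R, b = c * a.

Definition is_smith_normal_form (R : comUnitRingType) (t : nat)
    (M D : 'M[R]_t) : Prop :=
  [/\ \det M != 0,
      is_diag_mx D,
      exists P Q : 'M[R]_t,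
        [/\ P \in unitmx, Q \in unitmx & D = P *m M *m Q]
    & forall i j : 'I_t, j = i.+1 :> nat -> ring_dvd (D i i) (D j j)].

(* Main.v *)
Require Import Defs.
From mathcomp Require Import all_boot all_order all_algebra.
From mathcomp Require Import fingroup perm zify ring.

Import GRing.Theory.
Local Open Scope ring_scope.

(** Rows and columns are numbered from 0.  Write h_m(n) for the polynomial
    binomial coefficient (n+m-1 choose m), the coefficient of x^m in
    (1-x)^(-n).  Multiplying the series by (1-x)^j is a column operation with
    integer coefficients which turns column j of the matrix into h_m(n-j),
    where m = la_i + j - i, and
    h_m(n-j) = (n-j)(n-j+1)...(n+la_i-i-1) / m! if m >= 0.
    Up to a rational constant every entry is thus a product of linear factors
    n+c over an interval of integers c whose lower end -j depends only on the
    column and whose upper end only on the row.  After a shift by t the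
    interval for row i and column j is [t-j, beta i), where the beta i are the
    strictly decreasing beta numbers of the partition, and the constant is
    1/(beta i - (t-j))!, read as 0 if t-j > beta i (phi_JT_factored).

    A row k >= i can be multiplied by the linear factors with index in
    [beta k, beta i) and then lies over the same intervals as row i.  So a
    rational linear relation among the rows k >= i of the constant matrix
    (1/(beta k - (t-j))!) is realised by a row operation over Q[n] that is
    upper triangular.  The rows of the constant matrix are evaluations of
    polynomials at the distinct nodes beta k, so divided differences supply a
    combination with nonzero coefficient on row i that vanishes in all columns
    left of one column w(i) and not in column w(i) (row_relation).  After these
    row operations all entries of row i are divisible by the product over
    [pivot i, beta i), where pivot i = t - w(i), and the cofactor matrix is
    triangular with nonzero constant diagonal once its rows are permuted by w
    (pivot_inj shows that w is a permutation), hence invertible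
    (phi_JT_equiv_hooks).

    Finally pivot i is chosen by the shape of the partition so that the
    interval [pivot i, beta i) is, after the shift, the set of contents of the
    i-th diagonal hook (diag_hook_prod).  These intervals are nested, which is
    the divisibility chain; reversing the order of the rows and columns puts it
    in increasing order. *)

(** * Divided differences *)

Definition lagrange_weight (F : fieldType) (s : seq F) (x : F) : F :=
  (\prod_(y <- rem x s) (x - y))^-1.

Lemma lagrange_weight_neq0 (F : fieldType) (s : seq F) (x : F) :
  uniq s -> lagrange_weight F s x != 0.
Proof.
move=> us; rewrite invr_eq0 prodf_seq_neq0; apply/allP=> y.
by rewrite mem_rem_uniq // subr_eq0 eq_sym => /andP[].
Qed.

(** The sum is the coefficient of degree (size s).-1 in the Lagrange
    interpolation of p at the nodes s; the interpolation is p itself, whose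
    degree is smaller. *)
Lemma divided_difference_eq0 (F : fieldType) (s : seq F) (p : {poly F}) :
  uniq s -> (size p < size s)%N ->
  \sum_(x <- s) p.[x] * lagrange_weight F s x = 0.
Proof.
move=> us ltps.
pose L x := \prod_(y <- rem x s) ('X - y%:P).
pose q := \sum_(x <- s) (p.[x] * lagrange_weight F s x) *: L x.
have sizeL x : x \in s -> size (L x) = size s.
  by move=> xs; rewrite size_prod_XsubC size_rem //; case: (s) xs.
have qE x : x \in s -> q.[x] = p.[x].
  move=> xs; rewrite horner_sum (perm_big _ (perm_to_rem xs)) big_cons /=.
  rewrite big1_seq ?addr0 => [|y].
    rewrite hornerZ horner_prod -mulrA.
    under [X in _ * (_ * X)]eq_bigr do rewrite hornerXsubC.
    rewrite mulVf ?mulr1 //.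
    by rewrite -invr_eq0; apply: lagrange_weight_neq0.
  rewrite mem_rem_uniq // !inE => /andP[_ /andP[yx ys]].
  rewrite hornerZ horner_prod (big_rem x) /=; last first.
    by rewrite mem_rem_uniq // !inE xs andbT eq_sym.
  by rewrite hornerXsubC subrr mul0r mulr0.
have sizeq : (size q <= size s)%N.
  rewrite /q big_seq; elim/big_ind: _ => [|u v|x xs].
  - by rewrite size_poly0.
  - by move=> su sv; rewrite (leq_trans (size_polyD _ _)) // geq_max su.
  - by rewrite (leq_trans (size_scale_leq _ _)) // sizeL.
have pq : q = p.
  apply/eqP; rewrite -subr_eq0; apply: contraLR ltps => nz.
  rewrite -leqNgt; have := max_poly_roots nz _ us.
  have: all (root (q - p)) s.
    by apply/allP => x xs; rewrite /root !hornerE qE ?subrr.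
  move=> -> /(_ isT) lt.
  have := leq_trans lt (size_polyD _ _).
  rewrite size_polyN leq_max ltnNge sizeq /=; exact: ltnW.
(* compare the coefficients of degree one less than the number of nodes *)
have := congr1 (fun r : {poly F} => r`_(size s).-1) pq.
rewrite [p`_ _]nth_default; last by case: (size s) ltps.
rewrite coef_sum => h; rewrite -[RHS]h; apply: eq_big_seq => x xs.
rewrite coefZ -(sizeL _ xs) -/(lead_coef _).
by rewrite (monicP (monic_prod_XsubC _ _ _)) mulr1.
Qed.

(** * Beta numbers and pivots of a partition *)

(** The length of column k: the parts decrease, so the first row of length at
    most k comes right after all the rows that meet column k. *)
Definition conj_part (la : seq nat) (k : nat) : nat :=
  find (fun x => x <= k)%N la.

Lemma part_antitone (la : seq nat) (i j : nat) :
  is_partition la -> (i <= j)%N -> (part la j <= part la i)%N.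
Proof.
case/andP=> sla _ ij; rewrite /part.
case: (ltnP j (size la)) => [js|js]; last by rewrite nth_default.
have geq_tr : transitive geq by move=> y x z /= yx zy; apply: leq_trans yx.
by apply: (sorted_leq_nth geq_tr leqnn 0%N sla);
  rewrite ?inE ?(leq_ltn_trans ij).
Qed.

Lemma conj_partP (la : seq nat) (i k : nat) :
  is_partition la -> (i < conj_part la k)%N = (k < part la i)%N.
Proof.
move=> pla; rewrite /conj_part; apply/idP/idP => [/(before_find 0%N)|].
  by rewrite -/(part _ _); lia.
apply: contraLR; rewrite -!leqNgt => le.
apply: leq_trans (part_antitone _ _ _ pla le) _.
case: (boolP (has (fun x => x <= k)%N la)) => [/(nth_find 0%N) //|/hasNfind].
by rewrite /part => ->; rewrite nth_default.
Qed.

Lemma conj_part_le (la : seq nat) (k : nat) : (conj_part la k <= size la)%N.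
Proof. exact: find_size. Qed.

(** The usual beta numbers of the partition padded to t parts, plus one; the
    shift by t of part la i - i makes them natural numbers. *)
Definition beta (la : seq nat) (t i : nat) : nat := (part la i + (t - i))%N.

(** In both cases the interval from the pivot to the beta number is, up to the
    shift by t, the interval of contents of the diagonal hook of corner (i, i):
    the foot of that hook has content i.+1 - conj_part la i, and the interval
    is empty when (i, i) lies outside the diagram. *)
Definition pivot (la : seq nat) (t i : nat) : nat :=
  if (i < part la i)%N then (t - conj_part la i + i.+1)%N else beta la t i.

Lemma beta_decr (la : seq nat) (t i j : nat) :
  is_partition la -> (i < j)%N -> (i < t)%N -> (beta la t j < beta la t i)%N.
Proof.
by move=> pla ij it; have := part_antitone la i j pla; rewrite /beta; lia.
Qed.

Lemma pivot_bounds (la : seq nat) (t i : nat) :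
  is_partition la -> (size la <= t)%N -> (i < t)%N ->
  (0 < pivot la t i <= t)%N.
Proof.
move=> pla st it; rewrite /pivot /beta; have := conj_partP la i i pla.
by have := conj_part_le la i; case: ifP; lia.
Qed.

Lemma pivot_le_beta (la : seq nat) (t i : nat) :
  is_partition la -> (size la <= t)%N -> (i < t)%N ->
  (pivot la t i <= beta la t i)%N.
Proof.
move=> pla st it; have := pivot_bounds la t i pla st it.
by rewrite /pivot; case: ifP => //; rewrite /beta; lia.
Qed.

(** The values in the first case of the definition of pivot are those that the
    second case leaves out of 1, ..., t: this is the classical description of
    the gaps between beta numbers by the conjugate partition. *)
Lemma pivot_inj (la : seq nat) (t i j : nat) :
  is_partition la -> (size la <= t)%N -> (i < j)%N -> (j < t)%N ->
  pivot la t i != pivot la t j.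
Proof.
move=> pla st ij jt; rewrite /pivot /beta.
have cj : (conj_part la j <= conj_part la i)%N.
  have := conj_partP la (conj_part la j).-1 i pla.
  have := conj_partP la (conj_part la j).-1 j pla; lia.
have := conj_partP la j i pla; have := conj_partP la i i pla.
have := conj_partP la j j pla.
have := part_antitone la i j pla; have := conj_part_le la i.
have := conj_part_le la j.
case: ifP; case: ifP; lia.
Qed.

(** * Relations among rows of inverse factorials *)

Definition inv_fact (y b : nat) : rat :=
  if (y <= b)%N then (b - y)`!%:R^-1 else 0.

Lemma natr_rat_inj : injective (fun n : nat => n%:R : rat).
Proof. by move=> m n /eqP; rewrite Num.Theory.eqr_nat => /eqP. Qed.

Lemma factr_neq0 (n : nat) : (n`!%:R : rat) != 0.
Proof. by rewrite Num.Theory.pnatr_eq0 -lt0n fact_gt0. Qed.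

Lemma natr_ffact (R : comPzRingType) (n d : nat) :
  \prod_(c < d) (n%:R - c%:R) = (n ^_ d)%:R :> R.
Proof.
elim: d => [|d IH]; first by rewrite big_ord0.
rewrite big_ord_recr IH ffactnSr natrM /=.
case: (leqP d n) => [dn|nd]; first by rewrite natrB.
by rewrite ffact_small // !mul0r.
Qed.

(** Clearing the denominator of the row with node b turns its entries into a
    polynomial in b of degree y - v.+1.  The falling product has a factor zero
    exactly when y exceeds b, so the convention inv_fact y b = 0 agrees with
    it. *)
Lemma fact_mul_inv_fact (v y b : nat) : (v < y)%N -> (v < b)%N ->
  (b - v.+1)`!%:R * inv_fact y b =
  \prod_(c < y - v.+1) (b%:R - (v.+1 + c)%:R) :> rat.
Proof.
move=> vy vb; under eq_bigr do rewrite natrD opprD addrA -natrB //.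
rewrite natr_ffact /inv_fact; case: leqP => [yb|by_]; last first.
  by rewrite mulr0 ffact_small //; lia.
apply: (mulIf (factr_neq0 (b - y))); rewrite mulfVK ?factr_neq0 // -natrM.
have -> : (b - y = b - v.+1 - (y - v.+1))%N by lia.
by rewrite ffact_fact //; lia.
Qed.

(** The divided-difference weight, corrected by the factorial that makes the
    row polynomial in the node (fact_mul_inv_fact). *)
Definition node_coef (bs : seq nat) (v b : nat) : rat :=
  lagrange_weight rat [seq c%:R | c <- bs] b%:R * (b - v.+1)`!%:R.

Lemma node_coef_neq0 (bs : seq nat) (v b : nat) :
  uniq bs -> node_coef bs v b != 0.
Proof.
move=> us; rewrite mulf_neq0 ?factr_neq0 // lagrange_weight_neq0 //.
by rewrite map_inj_uniq //; apply: natr_rat_inj.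
Qed.

Lemma node_coef_vanish (bs : seq nat) (v y : nat) :
    uniq bs -> all (ltn v) bs -> (v < y < v + size bs)%N ->
  \sum_(b <- bs) node_coef bs v b * inv_fact y b = 0.
Proof.
move=> us /allP vbs /andP[vy ylt].
have us' : uniq [seq c%:R : rat | c <- bs].
  by rewrite map_inj_uniq //; apply: natr_rat_inj.
pose p : {poly rat} := \prod_(c < y - v.+1) ('X - (v.+1 + c)%:R%:P).
have := divided_difference_eq0 _ _ p us'; rewrite size_map big_map => h.
rewrite -[RHS]h; last first.
  by rewrite size_prod_XsubC [index_enum _]unlock -enumT size_enum_ord; lia.
apply: eq_big_seq => b /vbs /= vb.
rewrite /node_coef -mulrA fact_mul_inv_fact // mulrC; congr (_ * _).
by rewrite horner_prod; apply: eq_bigr => c _; rewrite hornerXsubC.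
Qed.

(** At y = v the row is the function 1/(b - v) of the node b.  Adjoining v to
    the nodes turns its divided difference into the tail of a divided
    difference of the constant 1, so it is the opposite of the weight of v. *)
Lemma node_coef_sum_neq0 (bs : seq nat) (v : nat) :
    uniq bs -> all (ltn v) bs -> (0 < size bs)%N ->
  \sum_(b <- bs) node_coef bs v b * inv_fact v b != 0.
Proof.
move=> us /allP vbs bs_gt0.
set s := [seq c%:R : rat | c <- bs].
have us' : uniq (v%:R :: s).
  rewrite -[_ :: s]/(map _ (v :: bs)) map_inj_uniq; last exact: natr_rat_inj.
  by rewrite /= us andbT; apply/negP => /vbs; rewrite /= ltnn.
have := divided_difference_eq0 _ (v%:R :: s) 1 us'.
rewrite size_poly1 /= !size_map ltnS bs_gt0 big_cons => /(_ isT) /eqP.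
rewrite !hornerC mul1r addr_eq0 => /eqP h.
suff -> : \sum_(b <- bs) node_coef bs v b * inv_fact v b =
    - lagrange_weight rat (v%:R :: s) v%:R.
  by rewrite oppr_eq0 lagrange_weight_neq0.
rewrite h opprK big_map; apply: eq_big_seq => b bbs.
have vb := vbs _ bbs; rewrite /= in vb.
rewrite hornerC mul1r /node_coef /inv_fact (ltnW vb) /lagrange_weight /=.
have /negPf -> : v%:R != b%:R :> rat by rewrite Num.Theory.eqr_nat; lia.
rewrite big_cons invfM [RHS]mulrC -mulrA; congr (_ * _).
rewrite -natrB ?(ltnW vb) //.
have -> : (b - v = (b - v.+1).+1)%N by lia.
by rewrite factS natrM invfM mulrCA divff ?mulr1 ?factr_neq0.
Qed.

(** If (i, i) is not in the diagram, row i has its first nonzero entry at the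
    pivot already.  Otherwise the rows i, ..., conj_part la i - 1 have all their
    nodes above the pivot, and they are as many as the columns up to the pivot
    column: one more than the columns that must vanish, as divided differences
    require. *)
Lemma row_relation (la : seq nat) (t i : nat) :
    is_partition la -> (size la <= t)%N -> (i < t)%N ->
  exists u : nat -> rat,
  [/\ u i != 0,
      forall k, (k < i)%N -> u k = 0,
      forall y, (pivot la t i < y <= t)%N ->
        \sum_(k < t) u k * inv_fact y (beta la t k) = 0
    & \sum_(k < t) u k * inv_fact (pivot la t i) (beta la t k) != 0].
Proof.
move=> pla st it.
have [ilt|ige] := ltnP i (part la i); last first.
  exists (fun k => (k == i)%:R).
  have sumE y : \sum_(k < t) (k == i :> nat)%:R * inv_fact y (beta la t k) =
      inv_fact y (beta la t i).
    rewrite (bigD1 (Ordinal it)) //= eqxx mul1r big1 ?addr0 // => k ki.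
    by rewrite -val_eqE /= in ki; rewrite (negPf ki) mul0r.
  rewrite /pivot ltnNge ige eqxx oner_eq0; split=> //.
  - by move=> k ki; rewrite ltn_eqF.
  - by move=> y /andP[yb _]; rewrite sumE /inv_fact leqNgt yb.
  - by rewrite sumE /inv_fact leqnn invr_eq0 factr_neq0.
have ci := conj_part_le la i; set c := conj_part la i in ci.
have ic : (i < c)%N by rewrite conj_partP.
set v := pivot la t i.
have vE : v = (t - c + i.+1)%N by rewrite /v /pivot ilt.
pose rows := iota i (c - i).
have rowsP k : (k \in rows) = (i <= k < c)%N by rewrite mem_iota; lia.
pose bs := map (beta la t) rows.
have beta_inj : {in rows &, injective (beta la t)}.
  move=> k l; rewrite !rowsP => /andP[ik kc] /andP[il lc] e.
  have := beta_decr la t k l pla; have := beta_decr la t l k pla; lia.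
have us : uniq bs by rewrite map_inj_in_uniq // iota_uniq.
have szbs : size bs = (c - i)%N by rewrite size_map size_iota.
have vbs : all (ltn v) bs.
  apply/allP => _ /mapP[k + ->]; rewrite rowsP => /andP[ik kc] /=.
  by have := conj_partP la k i pla; rewrite vE /beta; lia.
pose u k := if (i <= k < c)%N then node_coef bs v (beta la t k) else 0.
have sumE y : \sum_(k < t) u k * inv_fact y (beta la t k) =
    \sum_(b <- bs) node_coef bs v b * inv_fact y b.
  rewrite big_map -(big_mkord xpredT (fun k => u k * inv_fact y (beta la t k))).
  rewrite (big_cat_nat _ (n := i)) ?addr0 //=; last exact: ltnW.
  rewrite (big_cat_nat _ (m := i) (n := c)) ?addr0 //=; try lia.
  rewrite [X in X + _]big_nat_cond big1 ?add0r; last first.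
    by move=> k; rewrite /u => H; case: ifP => [|_]; [lia | rewrite mul0r].
  rewrite [X in _ + X]big_nat_cond [X in _ + X]big1 ?addr0; last first.
    by move=> k; rewrite /u => H; case: ifP => [|_]; [lia | rewrite mul0r].
  rewrite /index_iota -/rows; apply: eq_big_seq => k; rewrite rowsP /u => ->.
  by [].
exists u; split.
- by rewrite /u leqnn ic node_coef_neq0.
- by move=> k ki; rewrite /u leqNgt ki.
- by move=> y yP; rewrite sumE node_coef_vanish //; lia.
- by rewrite sumE node_coef_sum_neq0 //; lia.
Qed.

(** * Factoring the entries by column operations *)

(** The index c is a content shifted by t, as the beta numbers are. *)
Definition interval_prod (t x y : nat) : {poly rat} :=
  \prod_(x <= c < y) ('X + c%:R - t%:R).

Lemma interval_prod_cat (t x y z : nat) : (x <= y)%N -> (y <= z)%N ->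
  interval_prod t x z = interval_prod t x y * interval_prod t y z.
Proof. by move=> xy yz; rewrite /interval_prod (big_cat_nat xy yz). Qed.

Lemma interval_prod_nil (t x : nat) : interval_prod t x x = 1.
Proof. by rewrite /interval_prod big_geq. Qed.

(** The polynomial h_m(n - j) with m = b - y, and 0 if y > b. *)
Definition shifted_binom (j y b : nat) : {poly rat} :=
  inv_fact y b *: \prod_(c < b - y) ('X - j%:R + c%:R).

(** The generating function is multiplied by 1 - x when n decreases by 1. *)
Lemma shifted_binom_pascal (j y b : nat) :
  shifted_binom j.+1 y b = shifted_binom j y b - shifted_binom j y.+1 b.
Proof.
rewrite /shifted_binom /inv_fact; case: (ltngtP y b) => [yb|by_|->].
- have -> : (b - y = (b - y.+1).+1)%N by lia.
  set m := (b - y.+1)%N.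
  have -> : \prod_(c < m.+1) ('X - j.+1%:R + c%:R) =
      ('X - j.+1%:R) * \prod_(c < m) ('X - j%:R + c%:R) :> {poly rat}.
    rewrite big_ord_recl addr0; congr (_ * _); apply: eq_bigr => c _.
    by rewrite /bump /= !mulrS; ring.
  have -> : (m`!%:R^-1 = m.+1%:R * (m.+1)`!%:R^-1 :> rat).
    rewrite factS natrM invfM mulrA divff ?mul1r //.
    by rewrite Num.Theory.pnatr_eq0.
  rewrite -scalerA [_.+1%:R *: (_ *: _)]scalerA [_.+1%:R * _]mulrC -scalerA.
  rewrite -scalerBr; congr (_ *: _); rewrite big_ord_recr /= scaler_nat.
  by rewrite -mulr_natl !mulrS; ring.
- by rewrite !scale0r subr0.
- by rewrite subnn !big_ord0 scale0r subr0.
Qed.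

(** Multiplication of the generating function by (1 - x)^j.  The bound N is any
    number above j, the terms beyond j being zero; this slack lets the induction
    use two different values of N. *)
Lemma shifted_binom_expand (N j y b : nat) : (j < N)%N ->
  shifted_binom j y b =
  \sum_(k < N) ((-1) ^+ k *+ 'C(j, k)) * shifted_binom 0 (y + k) b.
Proof.
elim: j N y => [|j IH] [|N] y // jN.
  rewrite big_ord_recl big1 ?addr0 => [|k _]; first by rewrite addn0 mul1r.
  by rewrite bin0n mulr0n mul0r.
rewrite shifted_binom_pascal (IH N.+1 y) 1?ltnW // (IH N y.+1) //.
rewrite big_ord_recl [RHS]big_ord_recl -addrA; congr (_ + _).
  by rewrite !bin0.
rewrite -sumrB; apply: eq_bigr => k _; rewrite lift0 addSn addnS.
by rewrite -mulrBl binS mulrnDr exprS mulN1r [- _ *+ 'C(j, k)]mulNrn.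
Qed.

Lemma phi_JT_shifted_binom (la : seq nat) (t : nat) (i j : 'I_t) :
  phi_JT la t i j = shifted_binom 0 (t - j) (beta la t i).
Proof.
have it := ltn_ord i; have jt := ltn_ord j.
rewrite mxE /shifted_binom /inv_fact; case: leqP => le.
  have -> : (part la i)%:Z + j%:Z - i%:Z = (beta la t i - (t - j))%N%:Z.
    by rewrite /beta in le *; lia.
  by congr (_ *: _); apply: eq_bigr => c _; rewrite subr0.
rewrite scale0r; case E : (_ - _) => [n|n] //.
by rewrite /beta in le; lia.
Qed.

(** * Diagonalisation *)

Lemma unitmx_upper (R : comUnitRingType) (n : nat) (A : 'M[R]_n) :
    (forall i j : 'I_n, (j < i)%N -> A i j = 0) ->
    (forall i, A i i \is a GRing.unit) ->
  A \in unitmx.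
Proof.
move=> A0 A1; rewrite -unitmx_tr unitmxE det_trig.
  by apply: rpred_prod => i _; rewrite mxE.
by apply/is_trig_mxP => i j ij; rewrite mxE A0.
Qed.

Definition binomial_mx (t : nat) : 'M[{poly rat}]_t :=
  \matrix_(k < t, j < t) ((-1) ^+ (j - k) *+ 'C(j, k)).

Lemma binomial_mx_unit (t : nat) : binomial_mx t \in unitmx.
Proof.
apply: unitmx_upper => [i j ji|i]; rewrite mxE.
  by rewrite bin_small // mulr0n.
by rewrite subnn binn unitr1.
Qed.

(** For the shift by j equal to the column index, the lower end of the
    interval of linear factors no longer depends on the row. *)
Lemma phi_JT_factored (la : seq nat) (t : nat) (i j : 'I_t) :
  (phi_JT la t *m binomial_mx t) i j =
  inv_fact (t - j) (beta la t i) *: interval_prod t (t - j) (beta la t i).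
Proof.
have jt := ltn_ord j.
transitivity (shifted_binom j (t - j) (beta la t i)); last first.
  rewrite /shifted_binom /inv_fact; case: leqP => le; last by rewrite !scale0r.
  congr (_ *: _); rewrite -[in RHS](add0n (t - j)%N) /interval_prod.
  rewrite big_addn big_mkord.
  apply: eq_bigr => c _; rewrite natrD natrB; last exact: ltnW.
  by ring.
rewrite (shifted_binom_expand j.+1) // mxE.
transitivity (\sum_(k < j.+1)
    ((-1) ^+ (j - k) *+ 'C(j, k)) * shifted_binom 0 (t - k) (beta la t i)).
  rewrite (big_ord_widen t
    (fun k => ((-1) ^+ (j - k) *+ 'C(j, k)) *
              shifted_binom 0 (t - k) (beta la t i)) jt) [RHS]big_mkcond /=.
  apply: eq_bigr => k _; rewrite phi_JT_shifted_binom mxE mulrC ltnS.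
  by case: leqP => // jk; rewrite bin_small // mulr0n mul0r.
rewrite (reindex_inj rev_ord_inj) /=; apply: eq_bigr => k _.
have kj : (k <= j)%N by rewrite -ltnS.
rewrite subSS subKn // bin_sub //; congr (_ * shifted_binom _ _ _); lia.
Qed.

(** The product of n + c over the contents c of the i-th diagonal hook, by
    diag_hook_prod. *)
Definition hook_prod (la : seq nat) (t i : nat) : {poly rat} :=
  interval_prod t (pivot la t i) (beta la t i).

(** The column w(i) in which row i gets its pivot. *)
Lemma perm_pivot (la : seq nat) (t : nat) :
    is_partition la -> (size la <= t)%N ->
  exists s : 'S_t, forall i : 'I_t, (t - s i)%N = pivot la t i.
Proof.
move=> pla st.
have lt_t (i : 'I_t) : (t - pivot la t i < t)%N.
  by have := pivot_bounds la t i pla st (ltn_ord i); lia.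
pose w (i : 'I_t) := Ordinal (lt_t i).
have w_inj : injective w.
  move=> i j /(congr1 val) /= e; apply/val_inj => /=.
  have := pivot_bounds la t i pla st (ltn_ord i).
  have := pivot_bounds la t j pla st (ltn_ord j).
  have := pivot_inj la t i j pla st; have := pivot_inj la t j i pla st.
  have := ltn_ord i; have := ltn_ord j.
  by case: (ltngtP i j) => //; lia.
exists (perm w_inj) => i; rewrite permE /=.
by have := pivot_bounds la t i pla st (ltn_ord i); lia.
Qed.

(** The matrix P lifts the relations of row_relation to polynomial row
    operations: multiplying row k by the factors in [beta k, beta i) extends
    its intervals to the ones of row i.  Then the hook product of row i splits
    off, since only intervals starting at or below the pivot survive, and the
    remaining matrix E is triangular after a permutation of its rows. *)
Lemma phi_JT_equiv_hooks (la : seq nat) (t : nat) :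
    is_partition la -> (size la <= t)%N ->
  exists P Q : 'M[{poly rat}]_t,
    [/\ P \in unitmx, Q \in unitmx &
      P *m phi_JT la t *m Q = diag_mx (\row_i hook_prod la t i)].
Proof.
move=> pla st; have [s sE] := perm_pivot la t pla st.
have [u uP] := fin_all_exists (fun i : 'I_t =>
  row_relation la t i pla st (ltn_ord i)).
pose b := beta la t.
(* S is the constant matrix after the row operations *)
pose S (i j : 'I_t) := \sum_(k < t) u i k * inv_fact (t - j) (b k).
pose P : 'M[{poly rat}]_t :=
  \matrix_(i, k) (u i k *: interval_prod t (b k) (b i)).
pose E : 'M[{poly rat}]_t :=
  \matrix_(i, j) (S i j *: interval_prod t (t - j) (pivot la t i)).
have constU (c : rat) : c != 0 -> (c *: 1 : {poly rat}) \is a GRing.unit.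
  by move=> c0; rewrite alg_polyC rmorph_unit // unitfE.
have Pu : P \in unitmx.
  apply: unitmx_upper => [i k ki|i]; rewrite mxE.
    by have [_ -> //] := uP i; rewrite scale0r.
  by rewrite interval_prod_nil; apply: constU; have [] := uP i.
have S0 (i j : 'I_t) : (pivot la t i < t - j)%N -> S i j = 0.
  by move=> lt; have [_ _ h _] := uP i; apply: h; rewrite lt leq_subr.
have Eu : E \in unitmx.
  have : row_perm s^-1 E \in unitmx.
    apply: unitmx_upper => [i j ji|i]; rewrite !mxE.
      rewrite S0 ?scale0r // -sE permKV.
      by have := ltn_ord i; lia.
    rewrite -sE permKV interval_prod_nil; apply: constU.
    rewrite /S; have [_ _ _] := uP (s^-1%g i).
    by rewrite -sE permKV.
  by rewrite row_permE unitmx_mul => /andP[].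
have PGE : P *m (phi_JT la t *m binomial_mx t) =
    diag_mx (\row_i hook_prod la t i) *m E.
  apply/matrixP => i j; rewrite mul_diag_mx !mxE.
  transitivity (S i j *: interval_prod t (t - j) (b i)).
    rewrite scaler_suml; apply: eq_bigr => k _; rewrite phi_JT_factored mxE.
    have [ki|ik] := ltnP k i.
      by have [_ -> //] := uP i; rewrite mul0r !scale0r mul0r.
    rewrite -scalerAl -scalerAr scalerA /inv_fact; case: leqP => [yb|_].
      rewrite [RHS]/GRing.scale /= -/b in yb *; congr (_ *: _).
      rewrite mulrC -interval_prod_cat // /b.
      move: ik; rewrite leq_eqVlt => /predU1P[->//|ik].
      exact/ltnW/(beta_decr _ _ _ _ pla ik).
    by rewrite mulr0 !scale0r.
  (* left of the pivot column the constant is zero, from it on the pivot lies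
     inside the interval *)
  have [yp|py] := leqP (t - j) (pivot la t i); last first.
    by rewrite S0 // !scale0r mulr0.
  rewrite -scalerAr (interval_prod_cat _ _ _ _ yp) 1?mulrC //.
  exact: pivot_le_beta.
exists P, (binomial_mx t *m invmx E); split=> //.
  by rewrite unitmx_mul binomial_mx_unit unitmx_inv.
by rewrite !mulmxA -(mulmxA P) PGE mulmxK.
Qed.

(** The content interval of a diagonal hook contains that of the next one. *)
Lemma hook_prod_dvd (la : seq nat) (t i : nat) :
    is_partition la -> (size la <= t)%N -> (i.+1 < t)%N ->
  exists c, hook_prod la t i = c * hook_prod la t i.+1.
Proof.
move=> pla st it; rewrite /hook_prod.
have le_b := beta_decr la t i i.+1 pla (ltnSn i) (ltnW it).
have ple := pivot_le_beta la t i.+1 pla st it.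
have [small|big] := leqP (part la i.+1) i.+1.
  rewrite {2}/pivot ltnNge small /= interval_prod_nil.
  by exists (interval_prod t (pivot la t i) (beta la t i)); rewrite mulr1.
have lp : (pivot la t i <= pivot la t i.+1)%N.
  have := part_antitone la i i.+1 pla (leqnSn i).
  have := conj_part_le la i; have := conj_part_le la i.+1.
  have := conj_partP la (conj_part la i.+1).-1 i pla.
  have := conj_partP la (conj_part la i.+1).-1 i.+1 pla.
  by rewrite /pivot big; case: ifP; lia.
rewrite (interval_prod_cat _ _ _ _ lp) ?(leq_trans ple (ltnW le_b)) //.
rewrite (interval_prod_cat _ _ _ _ ple (ltnW le_b)).
exists (interval_prod t (pivot la t i) (pivot la t i.+1) *
        interval_prod t (beta la t i.+1) (beta la t i)).
by rewrite -!mulrA; congr (_ * _); rewrite mulrC.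
Qed.

Lemma interval_prod_neq0 (t x y : nat) : interval_prod t x y != 0.
Proof.
rewrite prodf_seq_neq0; apply/allP => c _ /=.
have -> : 'X + c%:R - t%:R = 'X - (t%:R - c%:R)%:P :> {poly rat}.
  by rewrite rmorphB !rmorph_nat; ring.
by rewrite polyXsubC_eq0.
Qed.

(** * Contents of the diagonal hooks *)

Lemma diag_hook_row_prod (la : seq nat) (k i : nat) :
  \prod_(j <- iota 0 (part la i) |
           ((i == k) && (k <= j)%N) || ((j == k) && (k <= i)%N))
     ('X + (content (i, j))%:~R) =
  if (i < k)%N then 1 else
  if i == k then \prod_(k <= j < part la k) ('X + (j%:R - k%:R)) else
  if (k < part la i)%N then 'X + (k%:R - i%:R) else 1 :> {poly rat}.
Proof.
have contE j : (content (i, j))%:~R = j%:R - i%:R :> {poly rat}.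
  by rewrite /content rmorphB.
under eq_bigr do rewrite contE.
case: (ltngtP i k) => [ik|ki|->].
- by apply: big_pred0 => j; rewrite andbF.
- under eq_bigl do rewrite /= andbT.
  case: (ltnP k (part la i)) => kp.
    rewrite big_mkcond (bigD1_seq k) ?mem_iota ?iota_uniq //= eqxx.
    by rewrite big1 ?mulr1 // => j /negPf ->.
  rewrite big_seq_cond big1 // => j; rewrite mem_iota => /andP[jp /eqP jk].
  by move: jp kp; rewrite jk; lia.
- under eq_bigl => j do rewrite /= andbT.
  rewrite [RHS](big_nat_widenl _ 0) //.
  have -> : iota 0 (part la k) = index_iota 0 (part la k).
    by rewrite /index_iota subn0.
  by apply: eq_bigl => j; lia.
Qed.

(** The arm, row k from its diagonal square on, has the contents from 0 to
    part la k - k - 1, and the leg below it the contents from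
    k + 1 - conj_part la k to -1. *)
Lemma diag_hook_prod (la : seq nat) (t k : nat) :
    is_partition la -> (size la <= t)%N -> (k < t)%N ->
  \prod_(u <- diag_hook la k) ('X + (content u)%:~R) = hook_prod la t k.
Proof.
move=> pla st kt.
rewrite big_filter /young_diagram big_mkcond big_allpairs_dep /=.
under eq_bigr do rewrite -big_mkcond diag_hook_row_prod.
pose F i := if (i < k)%N then 1 else
  if i == k then \prod_(k <= j < part la k) ('X + (j%:R - k%:R)) else
  if (k < part la i)%N then 'X + (k%:R - i%:R) else 1 : {poly rat}.
have F1 m n : (forall i, (m <= i < n)%N -> (i < k)%N || (part la i <= k)%N) ->
    \prod_(m <= i < n) F i = 1.
  move=> mn; rewrite big_nat big1 // => i /mn; rewrite /F.
  case: ltngtP => //= [_|->] le; first by rewrite ltnNge le.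
  by rewrite big_geq.
have part0 i : (size la <= i)%N -> part la i = 0%N by apply: nth_default.
transitivity (\prod_(0 <= i < t) F i).
  rewrite (big_cat_nat (leq0n _) st) /= (F1 (size la)) ?mulr1; last first.
    by move=> i /andP[/part0-> _]; rewrite orbT.
  by rewrite /index_iota subn0.
rewrite /hook_prod /pivot; case: ltnP => [kp|pk]; last first.
  rewrite interval_prod_nil F1 // => i _.
  by case: (ltnP i k) => //= ki;
    apply: leq_trans (part_antitone _ _ _ pla ki) pk.
have kc : (k < conj_part la k)%N by rewrite conj_partP.
have ct := leq_trans (conj_part_le la k) st.
set c := conj_part la k in kc ct *.
rewrite (big_cat_nat (leq0n k) (ltnW kt)) /= F1 ?mul1r; last first.
  by move=> i /andP[_ ->].
rewrite (big_cat_nat (leqnSn k) kt) /= big_nat1.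
rewrite (big_cat_nat kc ct) /= (F1 c) ?mulr1; last first.
  by move=> i /andP[ci _]; have := conj_partP la i k pla; rewrite -/c; lia.
rewrite (interval_prod_cat t _ t); [|lia|by rewrite /beta; lia].
rewrite mulrC; congr (_ * _).
  rewrite /interval_prod -[in LHS](add0n k.+1) big_addn.
  rewrite -[in RHS](add0n (_ + k.+1)%N) big_addn.
  have -> : (t - (t - c + k.+1) = c - k.+1)%N by lia.
  (* contents increase along intervals and decrease down the leg *)
  rewrite big_nat_rev; apply: eq_big_nat => i /andP[_ ic].
  rewrite add0n /F.
  have -> : (c - k.+1 - i.+1 + k.+1 = c - i.+1)%N by lia.
  have -> : (c - i.+1 < k)%N = false by lia.
  have -> : (c - i.+1 == k)%N = false by lia.
  rewrite -(conj_partP _ _ k pla) -/c; have -> : (c - i.+1 < c)%N by lia.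
  rewrite -addrA; congr (_ + _); apply/eqP.
  rewrite subr_eq addrAC eq_sym subr_eq.
  by rewrite -!natrD eq_sym; apply/eqP; congr (_%:R); lia.
rewrite /F ltnn eqxx /interval_prod -[in LHS](add0n k) big_addn.
rewrite -[in RHS](add0n t) big_addn /beta.
have -> : (part la k + (t - k) - t = part la k - k)%N by lia.
by apply: eq_bigr => i _; rewrite !natrD; ring.
Qed.

Theorem theorem1p1 (la : seq nat) (t : nat)
  (la_part : is_partition la) (la_pos : (0 < sumn la)%N)
  (le_la_t : (size la <= t)%N) :
  is_smith_normal_form (phi_JT la t)
    (diag_mx (\row_(i < t)
       \prod_(u <- diag_hook la (t - i.+1)%N) ('X + (content u)%:~R))).
Proof.
set D := diag_mx _.
have DE (i : 'I_t) : D i i = hook_prod la t (rev_ord i).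
  rewrite mxE eqxx mulr1n mxE (diag_hook_prod la t) //.
  by have := ltn_ord i; lia.
have [P [Q [Pu Qu PMQ]]] := phi_JT_equiv_hooks la t la_part le_la_t.
pose r : 'S_t := perm (@rev_ord_inj t).
have DPMQ : D = (perm_mx r *m P) *m phi_JT la t *m (Q *m perm_mx r^-1).
  rewrite !mulmxA -(mulmxA (perm_mx r)) -(mulmxA (perm_mx r)) PMQ.
  rewrite -row_permE -col_permE; apply/matrixP => i j.
  rewrite [LHS]mxE !mxE !permE (inj_eq rev_ord_inj).
  case: eqVneq => [_|_]; last by rewrite !mulr0n.
  by rewrite !mulr1n -DE /D !mxE eqxx mulr1n.
split.
(* a zero determinant would make one of the hook products zero *)
- apply: contraTneq (isT) => M0.
  have : \det D = 0 by rewrite DPMQ !det_mulmx M0 !(mulr0, mul0r).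
  move/eqP; rewrite det_diag prodf_seq_eq0 => /hasP[i _ /=].
  have -> : (\row_(i < t) \prod_(u <- diag_hook la (t - i.+1))
      ('X + (content u)%:~R)) 0 i = D i i by rewrite [RHS]mxE eqxx mulr1n.
  by rewrite DE (negPf (interval_prod_neq0 _ _ _)).
- exact: diag_mx_is_diag.
- exists (perm_mx r *m P), (Q *m perm_mx r^-1).
  by rewrite !unitmx_mul !unitmx_perm Pu Qu.
- move=> i j ji; rewrite !DE /ring_dvd /=.
  have := ltn_ord j; rewrite ji => it.
  have -> : (t - i.+1 = (t - i.+2).+1)%N by lia.
  by apply: hook_prod_dvd => //; lia.
Qed.
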